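(* The internal and external definitions of horizontal categorification are equivalent: for every category $\mathcal{C}$ and every monoid $M$, there exists a concentration structure $\sim$ on $\mathcal{C}$ such that $M_{(\mathcal{C},\sim)}\cong M$ (i.e. $\mathcal{C}$ is an internal horizontal categorification of $M$) if and only if there exists a $2$-lifting functor from $\mathcal{C}$ to $\mathcal{M}$ (i.e. $\mathcal{C}$ is an external horizontal categorification of $M$), where $\mathcal{M}$ is the one-object category with $\mathrm{Mor}( *,* )=M$ and composition given by multiplication in $M$.
   Context: The category $\mathcal{C}$ is small and nonempty. For a category $\mathcal{C}$, $\mathrm{Mor}_{\mathcal{C}}$ is the set of all its morphisms; $f\circ g$ means first $g$, then $f$. A concentration structure on $\mathcal{C}$ is an equivalence relation $\sim$ on $\mathrm{Mor}_{\mathcal{C}}$ such that: (1) $\mathrm{id}_A\sim \mathrm{id}_B$ for all objects $A,B$; (2) if $f\sim f'$, $g\sim g'$ and both $f\circ g$, $f'\circ g'$ exist, then $f\circ g\sim f'\circ g'$; (3) for any morphisms $f,g$ there exist $f'\sim f$ and $g'\sim g$ such that $f'\circ g'$ exists; (4) for any morphisms $f\sim f'$, $g\sim g'$, $h\sim h'$, $m\sim f\circ g$, $n\sim g'\circ h'$, one has $f'\circ n\sim m\circ h$ whenever all the compositions involved are defined. The concentration monoid of $(\mathcal{C},\sim)$ is $M_{(\mathcal{C},\sim)}=\mathrm{Mor}_{\mathcal{C}}/\sim$ with multiplication $[f][g]=[f'\circ g']$, where $f'\sim f$, $g'\sim g$ are any morphisms such that $f'\circ g'$ exists; its identity is the class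 of any identity morphism. A functor $F:\mathcal{C}\to\mathcal{D}$ is $2$-lifting if for any morphisms $g_1,g_2$ in $\mathcal{D}$ such that $g_1\circ g_2$ exists, there exist morphisms $f_1,f_2$ in $\mathcal{C}$ such that $f_1\circ f_2$ exists and $F(f_1)=g_1$, $F(f_2)=g_2$. *)

(* Defs.v *)
From HB Require Import structures.
From mathcomp Require Import all_boot.
From mathcomp Require Import boolp.

Set Implicit Arguments.
Unset Strict Implicit.
Unset Printing Implicit Defensive.

Record category := Category {
  obj :> Type;
  hom : obj -> obj -> Type;
  idm : forall A : obj, hom A A;
  comp : forall A B E : obj, hom B E -> hom A B -> hom A E;
  comp_idl : forall (A B : obj) (f : hom A B), comp (idm B) f = f;
  comp_idr : forall (A B : obj) (f : hom A B), comp f (idm A) = f;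
  compA : forall (A B E G : obj) (f : hom E G) (g : hom B E) (h : hom A B),
    comp f (comp g h) = comp (comp f g) h
}.
Arguments idm {c} A.

Declare Scope cat_scope.
Delimit Scope cat_scope with cat.
(* f ∘ g is g followed by f *)
Notation "f ∘ g" := (comp f g) (at level 40, left associativity) : cat_scope.
Local Open Scope cat_scope.

(* The set of all morphisms of C, with arbitrary endpoints. *)
Record mor (C : category) := Mor {
  source : C;
  target : C;
  arrow : hom source target
}.
Arguments Mor {C source target} arrow.

HB.instance Definition _ (C : category) := Choice.copy (mor C) {classic mor C}.

(* "f ∘ g exists" is expressed by giving f and g types of the form
   hom B E and hom A B; the relation itself compares arbitrary morphisms. *)
Record concentration (C : category) := Concentration {
  conc_rel :> mor C -> mor C -> Prop;
  conc_equiv : RelationClasses.Equivalence conc_rel;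
  conc_id : forall A B : C, conc_rel (Mor (idm A)) (Mor (idm B));
  conc_comp : forall (A B E : C) (f : hom B E) (g : hom A B)
      (A' B' E' : C) (f' : hom B' E') (g' : hom A' B'),
    conc_rel (Mor f) (Mor f') -> conc_rel (Mor g) (Mor g') ->
    conc_rel (Mor (f ∘ g)) (Mor (f' ∘ g'));
  conc_exists : forall f g : mor C,
    exists (A B E : C) (f' : hom B E) (g' : hom A B),
      conc_rel (Mor f') f /\ conc_rel (Mor g') g;
  (* the composites involved are f ∘ g, g' ∘ h', f' ∘ n and m ∘ h *)
  conc_assoc : forall (A1 B1 E1 : C) (f : hom B1 E1) (g : hom A1 B1)
      (A2 B2 E2 : C) (g' : hom B2 E2) (h' : hom A2 B2)
      (A3 B3 E3 : C) (f' : hom B3 E3) (n : hom A3 B3)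
      (A4 B4 E4 : C) (m : hom B4 E4) (h : hom A4 B4),
    conc_rel (Mor f) (Mor f') -> conc_rel (Mor g) (Mor g') ->
    conc_rel (Mor h) (Mor h') ->
    conc_rel (Mor m) (Mor (f ∘ g)) -> conc_rel (Mor n) (Mor (g' ∘ h')) ->
    conc_rel (Mor (f' ∘ n)) (Mor (m ∘ h))
}.

Section ConcentrationMonoid.
Variables (C : category) (S : concentration C).

Definition conc_relb : rel (mor C) := fun f g => `[< S f g >].

Fact conc_relb_refl : reflexive conc_relb.
Proof. by move=> f; apply/asboolP; case: (conc_equiv S) => r _ _; apply: r. Qed.

Fact conc_relb_sym : symmetric conc_relb.
Proof.
case: (conc_equiv S) => _ s _ f g.
by apply/asboolP/asboolP; apply: s.
Qed.

Fact conc_relb_trans : transitive conc_relb.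
Proof.
case: (conc_equiv S) => _ _ t g f h /asboolP fg /asboolP gh.
by apply/asboolP; apply: t fg gh.
Qed.

Canonical conc_equiv_rel :=
  EquivRel conc_relb conc_relb_refl conc_relb_sym conc_relb_trans.

Definition conc_quot : Type := {eq_quot conc_equiv_rel}%qT.

HB.instance Definition _ := Choice.copy conc_quot {eq_quot conc_equiv_rel}%qT.

Definition conc_class (f : mor C) : conc_quot :=
  (\pi_({eq_quot conc_equiv_rel}) f)%qT.

Lemma conc_classP (f g : mor C) : conc_class f = conc_class g <-> S f g.
Proof.
split=> [/eqquotP/asboolP //|fg].
by apply/eqquotP/asboolP.
Qed.

Lemma conc_class_surj (x : conc_quot) : exists f, x = conc_class f.
Proof. by exists (repr (x : {eq_quot conc_equiv_rel}%qT)); rewrite /conc_class reprK. Qed.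

Definition is_conc_prod (x y z : conc_quot) : Prop :=
  exists (A B E : C) (f : hom B E) (g : hom A B),
    [/\ x = conc_class (Mor f), y = conc_class (Mor g)
      & z = conc_class (Mor (f ∘ g))].

Lemma conc_prod_exists (x y : conc_quot) : exists z, is_conc_prod x y z.
Proof.
have [f ->] := conc_class_surj x; have [g ->] := conc_class_surj y.
have [A [B [E [f' [g' [ff' gg']]]]]] := conc_exists S f g.
exists (conc_class (Mor (f' ∘ g'))), A, B, E, f', g'.
by split=> //; apply/esym/conc_classP.
Qed.

Lemma conc_prod_unique (x y z z' : conc_quot) :
  is_conc_prod x y z -> is_conc_prod x y z' -> z = z'.
Proof.
move=> [A [B [E [f [g [-> -> ->]]]]]] [A' [B' [E' [f' [g' [ff' gg' ->]]]]]].
by apply/conc_classP/conc_comp; apply/conc_classP.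
Qed.

Definition conc_mul (x y : conc_quot) : conc_quot :=
  sval (cid (conc_prod_exists x y)).

Definition conc_one (hC : inhabited C) : conc_quot :=
  conc_class (Mor (idm (inhabited_witness hC))).

Lemma conc_mulE (A B E : C) (f : hom B E) (g : hom A B) :
  conc_mul (conc_class (Mor f)) (conc_class (Mor g)) =
  conc_class (Mor (f ∘ g)).
Proof.
rewrite /conc_mul; case: cid => z /= hz; apply: conc_prod_unique hz _.
by exists A, B, E, f, g.
Qed.

Lemma conc_oneE (hC : inhabited C) (A : C) : conc_one hC = conc_class (Mor (idm A)).
Proof. exact/conc_classP/conc_id. Qed.

Fact conc_mulA : associative conc_mul.
Proof.
move=> x y z.
have [xy [A1 [B1 [E1 [f [g [xE yE xyE]]]]]]] := conc_prod_exists x y.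
have [yz [A2 [B2 [E2 [g' [h' [yE' zE' yzE]]]]]]] := conc_prod_exists y z.
have [w [A3 [B3 [E3 [f' [n [xE' nE wE]]]]]]] := conc_prod_exists x yz.
have [w' [A4 [B4 [E4 [m [h [mE zE wE']]]]]]] := conc_prod_exists xy z.
have -> : conc_mul y z = yz by rewrite yE' zE' conc_mulE yzE.
have -> : conc_mul x y = xy by rewrite xE yE conc_mulE xyE.
rewrite {1}xE' nE conc_mulE mE zE conc_mulE; apply/conc_classP.
by apply: (@conc_assoc _ S _ _ _ f g _ _ _ g' h'); apply/conc_classP;
  rewrite -?xE -?xE' -?yE -?yE' -?zE -?zE' -?xyE -?yzE -?mE -?nE.
Qed.

Fact conc_mul1 (hC : inhabited C) : left_id (conc_one hC) conc_mul.
Proof.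
move=> x; have [[A B f] ->] := conc_class_surj x.
by rewrite (conc_oneE hC B) conc_mulE comp_idl.
Qed.

Fact conc_mulr1 (hC : inhabited C) : right_id (conc_one hC) conc_mul.
Proof.
move=> x; have [[A B f] ->] := conc_class_surj x.
by rewrite (conc_oneE hC A) conc_mulE comp_idr.
Qed.

(* Nonemptiness of C is what provides the identity element. *)
Definition conc_monoid (hC : inhabited C) : Type := conc_quot.

HB.instance Definition _ (hC : inhabited C) :=
  Choice.copy (conc_monoid hC) conc_quot.
HB.instance Definition _ (hC : inhabited C) :=
  isMonoid.Build (conc_monoid hC) conc_mulA (conc_mul1 hC) (conc_mulr1 hC).

End ConcentrationMonoid.
Arguments conc_monoid {C} S hC.

(* A monoidType carries a choiceType structure; with the axioms of boolp every
   type has one, so this does not restrict the class of monoids. *)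
Definition monoid_isomorphic (M N : monoidType) : Prop :=
  exists phi : M -> N, monoid_morphism phi /\ bijective phi.

Definition monoid_category (M : monoidType) : category :=
  @Category unit (fun _ _ => M) (fun _ => 1%g) (fun _ _ _ x y => (x * y)%g)
    (fun _ _ x => mul1g x) (fun _ _ x => mulg1 x)
    (fun _ _ _ _ x y z => mulgA x y z).

Record functor (C D : category) := Functor {
  fobj :> C -> D;
  fmap : forall A B : C, hom A B -> hom (fobj A) (fobj B);
  fmap_id : forall A : C, fmap (idm A) = idm (fobj A);
  fmap_comp : forall (A B E : C) (f : hom B E) (g : hom A B),
    fmap (f ∘ g) = fmap f ∘ fmap g
}.

(* The equalities are between morphisms with their endpoints, so they also
   force the endpoints of F(f1) and F(f2) to be those of g1 and g2. *)
Definition two_lifting (C D : category) (F : functor C D) : Prop :=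
  forall (A B E : D) (g1 : hom B E) (g2 : hom A B),
  exists (X Y Z : C) (f1 : hom Y Z) (f2 : hom X Y),
    Mor (fmap F f1) = Mor g1 /\ Mor (fmap F f2) = Mor g2.

(* Main.v *)
Require Import Defs.
From mathcomp Require Import all_boot.
From mathcomp Require Import boolp.

(** A functor from [C] to the one-object category of [M] is the same thing as
    a labelling of the morphisms of [C] by elements of [M] that sends
    identities to [1] and composites to products.

    From a concentration structure [S] and an isomorphism [phi] from its
    monoid to [M], the labelling is [f |-> phi [f]].  It is 2-lifting because
    [phi] is onto and any two classes have composable representatives, which
    is axiom (3): see [class_functor_two_lifting].

    From a 2-lifting functor [F], take the relation of having the same label.
    Axioms (1) and (2) are functoriality, axiom (4) is associativity in [M],
    and axiom (3) is the 2-lifting property applied to the labels of the two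
    given morphisms: see [kernel_concentration].  The label is then a
    well-defined, injective and multiplicative function of the class, and it
    is onto because 2-lifting implies that every element of [M] is a label, so
    that it is an isomorphism: see [kernel_monoid_isomorphic]. *)

Set Implicit Arguments.
Unset Strict Implicit.
Unset Printing Implicit Defensive.

Local Open Scope cat_scope.
Local Open Scope group_scope.

Section ClassFunctor.
Variables (C : category) (hC : inhabited C) (M : monoidType).
Variables (S : concentration C) (phi : conc_monoid S hC -> M).
Hypothesis phiM : monoid_morphism phi.

Definition class_value (A B : C) (f : hom A B) : M :=
  phi (conc_class S (Mor f)).

Fact class_value_id (A : C) : class_value (idm A) = 1.
Proof. by rewrite /class_value -(conc_oneE S hC); case: phiM. Qed.

Fact class_value_comp (A B E : C) (f : hom B E) (g : hom A B) :
  class_value (f ∘ g) = class_value f * class_value g.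
Proof. by rewrite /class_value -conc_mulE; case: phiM => _ ->. Qed.

Definition class_functor : functor C (monoid_category M) :=
  @Functor C (monoid_category M) (fun _ => tt) class_value
    class_value_id class_value_comp.

(** The two elements of [M] are values of [phi] at two classes, and two classes
    always have composable representatives, which is what
    [conc_prod_exists] provides. *)
Lemma class_functor_two_lifting :
  (forall x : M, exists c, phi c = x) -> two_lifting class_functor.
Proof.
move=> phi_onto [] [] [] x y.
have [c <-] := phi_onto x; have [d <-] := phi_onto y.
have [_ [A [B [E [f [g [-> -> _]]]]]]] := conc_prod_exists c d.
by exists A, B, E, f, g.
Qed.

End ClassFunctor.

Section Kernel.
Variables (C : category) (hC : inhabited C) (M : monoidType).
Variables (F : functor C (monoid_category M)).

(** The label of a morphism with arbitrary endpoints: every hom-set of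
    [monoid_category M] is [M], so that labels of non-parallel morphisms can be
    compared without transport. *)
Definition label (f : mor C) : M := fmap F (arrow f).

Lemma label_id (A : C) : label (Mor (idm A)) = 1.
Proof. exact: (fmap_id F A). Qed.

Lemma label_comp (A B E : C) (f : hom B E) (g : hom A B) :
  label (Mor (f ∘ g)) = label (Mor f) * label (Mor g).
Proof. exact: (fmap_comp F f g). Qed.

Hypothesis F_lifts : two_lifting F.

Lemma label_lift (x y : M) :
  exists (A B E : C) (f : hom B E) (g : hom A B),
    label (Mor f) = x /\ label (Mor g) = y.
Proof.
have [A [B [E [f [g [fx gy]]]]]] :=
  @F_lifts tt tt tt (x : @hom (monoid_category M) tt tt) y.
exists A, B, E, f, g; split.
  exact: (congr1 (fun m : mor (monoid_category M) => arrow m : M) fx).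
exact: (congr1 (fun m : mor (monoid_category M) => arrow m : M) gy).
Qed.

Definition same_label (f g : mor C) : Prop := label f = label g.

Fact same_label_equiv : RelationClasses.Equivalence same_label.
Proof. by split=> [f|f g|f g h]; rewrite /same_label // => -> ->. Qed.

Definition kernel_concentration : concentration C.
Proof.
apply: (@Concentration C same_label same_label_equiv); rewrite /same_label.
- by move=> A B; rewrite !label_id.
- by move=> A B E f g A' B' E' f' g' ff' gg'; rewrite !label_comp ff' gg'.
- by move=> f g; apply: label_lift.
- move=> A1 B1 E1 f g A2 B2 E2 g' h' A3 B3 E3 f' n A4 B4 E4 m h ff' gg' hh'.
  by rewrite !label_comp => -> ->; rewrite ff' gg' hh' mulgA.
Defined.

Definition class_label (c : conc_monoid kernel_concentration hC) : M :=
  label (sval (cid (conc_class_surj c))).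

(** The representative chosen in [class_label] is immaterial, since equivalent
    morphisms have equal labels by construction. *)
Lemma class_labelE (f : mor C) :
  class_label (conc_class kernel_concentration f) = label f.
Proof. by rewrite /class_label; case: cid => g /= /conc_classP. Qed.

Lemma class_label_morphism : monoid_morphism class_label.
Proof.
split=> [|c d].
  by rewrite [1]/(conc_one _ hC) /conc_one class_labelE label_id.
have [_ [A [B [E [f [g [-> -> _]]]]]]] := conc_prod_exists c d.
by rewrite [_ * _ in LHS]conc_mulE !class_labelE label_comp.
Qed.

Lemma class_label_inj : injective class_label.
Proof.
move=> c d; have [f ->] := conc_class_surj c; have [g ->] := conc_class_surj d.
by rewrite !class_labelE => fg; apply/conc_classP.
Qed.

Lemma class_label_onto (x : M) : exists c, class_label c = x.
Proof.
have [A [B [E [f [_ [fx _]]]]]] := label_lift x 1.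
by exists (conc_class kernel_concentration (Mor f)); rewrite class_labelE.
Qed.

Lemma kernel_monoid_isomorphic :
  monoid_isomorphic (conc_monoid kernel_concentration hC) M.
Proof.
exists class_label; split; first exact: class_label_morphism.
have labelK x : class_label (sval (cid (class_label_onto x))) = x.
  by case: cid.
exists (fun x => sval (cid (class_label_onto x))) => // c.
exact/class_label_inj/labelK.
Qed.

End Kernel.

Theorem theorem1p11 (C : category) (hC : inhabited C) (M : monoidType) :
  (exists S : concentration C, monoid_isomorphic (conc_monoid S hC) M) <->
  (exists F : functor C (monoid_category M), two_lifting F).
Proof.
split=> [[S [phi [phiM [psi _ psiK]]]]|[F F_lifts]].
  exists (class_functor phiM); apply: class_functor_two_lifting => x.
  by exists (psi x).
by exists (kernel_concentration F_lifts); apply: kernel_monoid_isomorphic.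
Qed.
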